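(* Let $n$ be a positive integer which is not a square and consider a solution $(a,b)$ (in integers) of the Pell equation $x^2-ny^2=1$. Let $d$ be a positive integer. The following conditions are equivalent: (1) There exists a parametric solution $P,Q,D\in\mathbb{Z}[X]$ of degree $d$ associated to $(a,b)$. (2) The integer $d$ divides $2\,(U:V(a,b))$.
   Context: Let $K=\mathbb{Q}(\sqrt n)$, with ring of integers $\mathcal{O}_K$. $U$ is the subgroup of $\mathcal{O}_K^\times$ consisting of the elements of norm $1$ (norm of $K/\mathbb{Q}$). For any integer solution $(a,b)$ of $x^2-ny^2=1$, $V(a,b)$ is the subgroup of $U$ generated by $a+b\sqrt{n}$ and $-1$, and $(U:V(a,b))$ is its index in $U$. A parametric solution associated to $(a,b)$ is a triple of polynomials $P,Q,D\in\mathbb{C}[X]$ with $\deg(D)=2$, $P^2-DQ^2=1$, $P(0)=a$, $Q(0)=b$ and $D(0)=n$. Its degree is $\deg(P)$.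
   Formalization: The solution (a,b) is assumed nontrivial (b ≠ 0): for (a,b) = (±1,0) the index (U:V(a,b)) is infinite, so condition (2) has no meaning, and no convention works for (1,0), since degree 1 is impossible while degree 2 occurs. *)

(* Defs.v *)
From HB Require Import structures.
From mathcomp Require Import all_boot all_order all_algebra all_fingroup all_field.
From mathcomp Require Import finmap boolp classical_sets functions cardinality.

Set Implicit Arguments.
Unset Strict Implicit.
Unset Printing Implicit Defensive.

Import Order.TTheory GRing.Theory Num.Theory.

Local Open Scope ring_scope.
Local Open Scope classical_set_scope.

Section MultiplicativeSubgroups.
Variable F : fieldType.

Definition is_mul_subgroup (H : set F) : Prop :=
  [/\ H 1, ~ H 0, forall x y, H x -> H y -> H (x * y)
    & forall x, H x -> H x^-1].

Definition generated_in (G A : set F) : set F :=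
  smallest (fun H => is_mul_subgroup H /\ H `<=` G) A.

Definition cosets (G H : set F) : set (set F) :=
  [set [set g * h | h in H] | g in G].

(* [fset_set] sends an infinite set to the empty one, so an infinite index is
   rendered as 0; for [pell_subgroup s a b] in the norm one units of a real
   quadratic field this only happens when b = 0. *)
Definition subgroup_index (G H : set F) : nat := #|` fset_set (cosets G H)|.

End MultiplicativeSubgroups.

Section Quadratic.
Variable K : splittingFieldType rat.

(* [s] is a square root of [n] and a generator of K over the prime field. *)
Definition is_quadratic_field (n : int) (s : K) : Prop :=
  s ^+ 2 = n%:~R /\ <<1; s>>%VS = fullv.

Definition ring_of_integers : set K :=
  [set x | integralOver (intr : int -> K) x].

Definition integer_units : set K :=
  [set x | [/\ x != 0, ring_of_integers x & ring_of_integers x^-1]].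

Definition norm_one_units : set K :=
  [set x | integer_units x /\ galNorm 1 fullv x = 1].

Definition pell_subgroup (s : K) (a b : int) : set K :=
  generated_in norm_one_units [set a%:~R + b%:~R * s; -1].

End Quadratic.

Definition pell_solution (n a b : int) : Prop := a ^+ 2 - n * b ^+ 2 = 1.

(* Polynomials over a subring of the complex numbers, such as [int], form a
   parametric solution exactly when their complex images do. *)
Definition parametric_solution (R : comNzRingType) (n a b : R)
    (P Q D : {poly R}) : Prop :=
  [/\ size D = 3, P ^+ 2 - D * Q ^+ 2 = 1,
      P.[0] = a, Q.[0] = b & D.[0] = n].

(* Main.v *)
Require Import Defs.
From HB Require Import structures.
From mathcomp Require Import all_boot all_order all_algebra all_fingroup all_field.
From mathcomp Require Import finmap boolp classical_sets functions cardinality.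
From mathcomp Require Import ring lra zify.

Set Implicit Arguments.
Unset Strict Implicit.
Unset Printing Implicit Defensive.

Import Order.TTheory GRing.Theory Num.Theory.

Local Open Scope ring_scope.

(** Write N = norm_one_units, and alpha = a + b s, where s ^+ 2 = n.

    Structure of the units.  N is the set of the signed powers +/- h ^ k of a
    single h, found by descent on the trace: among the elements x + y s of N
    with x > 1 and y > 0 take one with x minimal
    ([fundamental_unit_generates]).  Hence alpha = +/- h ^ m for some m, which
    is positive for h or its inverse because b <> 0, and the index of the group
    generated by alpha and -1 is m ([index_signed_powers]).  So the theorem
    says that parametric solutions of degree d exist exactly when d divides
    2 m.

    From a parametric solution to the divisibility.  If D has degree 2 and
    P ^+ 2 - D * Q ^+ 2 = 1 with Q != 0, comparing leading terms shows that D
    is r ^+ 2 * ((X + x0) ^+ 2 - f) with r the ratio of the leading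
    coefficients of P and Q.  The element w = (X + x0) + sqrt D / r has the
    constant norm f, and multiplying P + Q sqrt D by the conjugate of w lowers
    degrees by one; after d steps a constant is left.  Taking norms to find
    the square of that constant gives
    (P + Q sqrt D) ^+ 2 = (w ^+ 2 / f) ^+ d ([pell_power]).  At X = 0 this
    reads alpha ^+ 2 = z ^+ d, where z has norm one and is integral because
    z ^+ d is: thus z lies in N ([parametric_solution_unit]), z = +/- h ^ k,
    and 2 m = k d.

    From the divisibility to a parametric solution.  Let d k = 2 m.  If d is
    odd then k is even and +/- alpha is the d-th power of an element x + y s
    of N; if d = 2 e it is the e-th power of such an element.  With T_j and U_j
    the Chebyshev polynomials,
    (x + y s) ^+ j = T_j(x) + y U_(j-1)(x) s, and replacing x by a polynomial M
    with M(0) = x gives P = T_j(M), D Q ^+ 2 = (M ^+ 2 - 1) U_(j-1)(M) ^+ 2.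
    For d odd M = X + x is good, with D proportional to M ^+ 2 - 1.  For d even
    M = (x + 1) (X + 1) ^+ 2 - 1 is good: M ^+ 2 - 1 is then (M - 1) times a
    constant times a square, so D can be taken proportional to M - 1.  These
    polynomials are only rational, but their values at 0 are integers, and so
    substituting a multiple of X by a common denominator makes them integral
    ([parametric_solution_int]). *)

(** * The index of a subgroup of signed powers *)

Section SignedPowers.
Local Open Scope classical_set_scope.
Variables (F : fieldType) (h : F).
Hypothesis h_neq0 : h != 0.

(** The subgroup generated by h ^+ m and -1. *)
Definition signed_powers (m : nat) : set F :=
  [set u | exists (e : bool) (k : int), u = (-1) ^+ e * h ^ (m%:Z * k)].

Lemma signed_powersM m x y :
  signed_powers m x -> signed_powers m y -> signed_powers m (x * y).
Proof.
move=> [e [k ->]] [e' [k' ->]]; exists (e (+) e'), (k + k').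
by rewrite signr_addb mulrDr expfzDr // mulrACA.
Qed.

Lemma signed_powersV m x : signed_powers m x -> signed_powers m x^-1.
Proof.
move=> [e [k ->]]; exists e, (- k).
by rewrite invfM -exprVn invrN1 mulrN invr_expz.
Qed.

Lemma signed_powers_subgroup m : is_mul_subgroup (signed_powers m).
Proof.
split; [|move=> [e [k /eqP]]|exact: signed_powersM|exact: signed_powersV].
  by exists false, 0; rewrite mulr0 expr0z mul1r.
by rewrite eq_sym mulf_eq0 signr_eq0 (negPf (expfz_neq0 _ h_neq0)).
Qed.

Lemma generated_in_signed_powers (G : set F) (m : nat) (e : bool) :
    (forall u, G u <-> signed_powers 1 u) ->
  generated_in G [set (-1) ^+ e * h ^+ m; -1] = signed_powers m.
Proof.
move=> GE; apply/seteqP; split => u.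
  apply; split; first split; first exact: signed_powers_subgroup.
    move=> x [e' [k ->]]; apply/GE; exists e', (m%:Z * k).
    by rewrite mul1r.
  move=> x [->|->]; first by exists e, 1; rewrite mulr1.
  by exists true, 0; rewrite mulr0 expr0z mulr1.
move=> [e' [k ->]] H [[[H1 H0 HM HV] HG] gensH].
have HX x (j : nat) : H x -> H (x ^+ j).
  by move=> Hx; elim: j => [//|j IHj]; rewrite exprS; apply: HM.
have HN1 : H (-1) by apply: gensH; right.
have Hhm : H (h ^+ m).
  have -> : h ^+ m = (-1) ^+ e * ((-1) ^+ e * h ^+ m) by rewrite signrMK.
  by apply: HM; [apply: HX | apply: gensH; left].
apply: HM; first exact: HX.
rewrite -exprz_exp.
by case: k => k; [apply: HX | apply: HV; apply: HX].
Qed.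

(** The square makes h of infinite order and at the same time keeps -1 away from
    its nontrivial powers. *)
Hypothesis h_free : forall k : int, (h ^ k) ^+ 2 = 1 -> k = 0.

Lemma signed_powers_inj (e e' : bool) (k k' : int) :
  (-1) ^+ e * h ^ k = (-1) ^+ e' * h ^ k' -> k = k'.
Proof.
move=> /(congr1 (fun x => x ^+ 2)); rewrite !exprMn !sqrr_sign !mul1r => hkk'.
apply/eqP; rewrite -subr_eq0; apply/eqP/h_free.
rewrite expfzDr // -invr_expz exprMn hkk' exprVn divff //.
by rewrite expf_neq0 // expfz_neq0.
Qed.

(** The cosets are represented by h ^+ i for i < m: Euclidean division of the
    exponent by m reaches one of them, and [h_free] separates them. *)
Lemma index_signed_powers (G : set F) (m : nat) (e : bool) :
    (forall u, G u <-> signed_powers 1 u) -> (0 < m)%N ->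
  subgroup_index G (generated_in G [set (-1) ^+ e * h ^+ m; -1]) = m.
Proof.
move=> GE m_gt0; rewrite (generated_in_signed_powers _ _ GE).
rewrite /subgroup_index; apply: card_fset_set.
set V := signed_powers m.
have [V1 _ VM VV] : is_mul_subgroup V by exact: signed_powers_subgroup.
pose cst (i : nat) : set F := [set h ^+ i * v | v in V].
have -> : cosets G V = cst @` `I_m.
  apply/seteqP; split => C.
    move=> [g /GE[e' [k ->]] <-]; rewrite mul1r.
    pose i := `|(k %% m)%Z|%N.
    have iE : i%:Z = (k %% m)%Z by rewrite gez0_abs // modz_ge0; lia.
    exists i => /=; first by have := @ltz_pmod k m; lia.
    have kE : h ^ k = h ^+ i * h ^ (m%:Z * (k %/ m)%Z).
      rewrite -[h ^+ i]/(h ^ i%:Z) -expfzDr // iE; congr (h ^ _).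
      by rewrite addrC mulrC -divz_eq.
    apply/seteqP; split => x [v Vv <-].
      exists ((-1) ^+ e' * (h ^ (m%:Z * (k %/ m)%Z))^-1 * v).
        by apply: VM => //; exists e', (- (k %/ m)%Z); rewrite mulrN invr_expz.
      rewrite kE; set z := h ^ (_ * _).
      have z0 : z != 0 by rewrite expfz_neq0.
      transitivity (((-1) ^+ e' * (-1) ^+ e') * (z / z) * (h ^+ i * v)).
        by ring.
      by rewrite -signr_addb addbb divff // !mul1r.
    exists ((-1) ^+ e' * h ^ (m%:Z * (k %/ m)%Z) * v).
      by apply: VM => //; exists e', (k %/ m)%Z.
    by rewrite kE; ring.
  move=> [i _ <-]; exists (h ^+ i) => //.
  by apply/GE; exists false, i%:Z; rewrite !mul1r.
apply: inj_card_eq => i j; rewrite !inE /= => lim ljm ijE.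
have : cst j (h ^+ i) by rewrite -ijE; exists 1; rewrite ?mulr1.
move=> [_ [e' [k ->]] /esym]; rewrite mulrCA -[h ^+ j]/(h ^ j%:Z) -expfzDr //.
rewrite -[h ^+ i]mul1r -[h ^+ i]/(h ^ i%:Z) -[1](expr0 (-1)).
move=> /(@signed_powers_inj false) ijk.
have : (i %% m)%Z = (j %% m)%Z by rewrite ijk mulrC addrC modzMDl.
by rewrite !modz_small; lia.
Qed.

End SignedPowers.

(** * The Pell equation over polynomials with a quadratic discriminant *)

(** With the structures inferred from a field, the sizes on the right are
    syntactically those of the context, as linear arithmetic requires. *)
Lemma size_mulF (F : fieldType) (p q : {poly F}) :
  p != 0 -> q != 0 -> size (p * q) = (size p + size q).-1.
Proof. exact: size_mul. Qed.

Lemma pchar0_two (F : fieldType) : [pchar F] =i pred0 -> 2 != 0 :> F.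
Proof. by move=> /pcharf0P ->. Qed.

Section Descent.
Variables (F : fieldType) (f : F).
Hypotheses (F_char : [pchar F] =i pred0) (f_neq0 : f != 0).

(** The equation below is P ^+ 2 - (X ^+ 2 - f) * Q ^+ 2 = c written for
    R = P - X * Q, the form in which the cancellation of the leading terms of
    P and X * Q is visible.  The two factors R and R + 2 X Q = P + X Q multiply
    to c - f * Q ^+ 2, which fixes the degree of R. *)
Lemma size_pell_remainder (c : F) (Q R : {poly F}) :
    R ^+ 2 + 2%:P * 'X * Q * R + f%:P * Q ^+ 2 = c%:P ->
    (size R < size Q)%N -> (1 < size Q)%N -> size R = (size Q).-1.
Proof.
move=> eqQR ltRQ Q_gt1.
have Q0 : Q != 0 by rewrite -size_poly_gt0; lia.
have szXQ : size (2%:P * 'X * Q) = (size Q).+1.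
  by rewrite -mulrA mul_polyC size_scale ?pchar0_two // mulrC size_mulX.
have szS : size (R + 2%:P * 'X * Q) = (size Q).+1.
  by rewrite addrC size_polyDl szXQ //; lia.
have szQ2 : size (f%:P * Q ^+ 2) = (2 * size Q)%N.-1.
  by rewrite mul_polyC size_scale // expr2 size_mulF // addnn -mul2n.
have eqRS : R * (R + 2%:P * 'X * Q) = c%:P - f%:P * Q ^+ 2.
  by rewrite -eqQR; ring.
have szRS : size (R * (R + 2%:P * 'X * Q)) = (2 * size Q)%N.-1.
  rewrite eqRS addrC size_polyDl size_polyN szQ2 //.
  by have := size_polyC_leq1 c; lia.
have R0 : R != 0.
  by apply/eqP => R0; move: szRS; rewrite R0 mul0r size_poly0; lia.
have S0 : R + 2%:P * 'X * Q != 0 by rewrite -size_poly_gt0 szS.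
by move: szRS; rewrite size_mulF // szS; lia.
Qed.

(** Think of u and v as x0 + sqrt(x0 ^+ 2 - f) and its conjugate, so that
    R(x0) + Q(x0) u is P + Q sqrt(X ^+ 2 - f) at x0.  Multiplying
    P + Q sqrt(X ^+ 2 - f) by X - sqrt(X ^+ 2 - f) turns (Q, R, c) into
    (- R, 2 X R + f Q, c f), a solution of lower degree; when Q is constant R
    vanishes and the product is the constant Q f. *)
Lemma pell_descent (c x0 u v : F) (Q R : {poly F}) (d : nat) :
    c != 0 -> u * v = f -> u + v = 2 * x0 ->
    R ^+ 2 + 2%:P * 'X * Q * R + f%:P * Q ^+ 2 = c%:P ->
    (size R < size Q)%N -> size Q = d.+1 ->
  ((R.[x0] + Q.[x0] * u) * v ^+ d.+1) ^+ 2 = c * f ^+ d.+1.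
Proof.
move=> c_neq0 uv upv; elim: d => [|d IHd] in c c_neq0 Q R *.
  move=> eqQR ltRQ szQ.
  have R0 : R = 0 by apply/eqP; rewrite -size_poly_eq0; lia.
  have /size1_polyC QE : (size Q <= 1)%N by rewrite szQ.
  move: eqQR; rewrite R0 QE !hornerE => /(congr1 (horner^~ x0)).
  rewrite !hornerE => <-; rewrite -uv; ring.
move=> eqQR ltRQ szQ.
have szR : size R = d.+1 by rewrite (size_pell_remainder eqQR ltRQ) szQ.
have Q0 : Q != 0 by rewrite -size_poly_gt0 szQ.
pose S : {poly F} := 2%:P * 'X * R + f%:P * Q.
(* The successor equation S (S - 2 X R) = c f - f R ^+ 2, divided by f. *)
have eqS : S * Q = c%:P - R ^+ 2 by rewrite -eqQR /S; ring.
have ltSR : (size S < size (- R)%R)%N.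
  rewrite size_polyN szR; have [->|S0] := eqVneq S 0; first by rewrite size_poly0.
  have : (size (S * Q)%R <= maxn 1 (2 * size R)%N.-1)%N.
    rewrite eqS (leq_trans (size_polyD _ _)) // geq_max size_polyN.
    rewrite (leq_trans (size_polyC_leq1 c)) ?leq_maxl //=.
    rewrite leq_max; apply/orP; right.
    by rewrite expr2 mul2n -addnn size_polyMleq.
  by rewrite size_mulF // szQ szR; lia.
have eqS' : S ^+ 2 + 2%:P * 'X * (- R) * S + f%:P * (- R) ^+ 2 = (c * f)%:P.
  by rewrite polyCM -eqQR /S; ring.
have IH := IHd (c * f) (mulf_neq0 c_neq0 f_neq0) (- R) S eqS' ltSR _.
transitivity (c * f * f ^+ d.+1); last by rewrite -mulrA -exprS.
rewrite -IH ?size_polyN //; congr (_ ^+ 2).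
rewrite [v ^+ d.+2]exprS mulrA; congr (_ * _).
by rewrite /S !hornerE -upv -uv; ring.
Qed.

End Descent.

Section PolynomialPell.
Variables (F : fieldType).
Hypotheses (F_char : [pchar F] =i pred0).

(** After the change of variable X := X - x0 and the scaling of Q by r the
    discriminant is X ^+ 2 - f, and the value at 0 becomes a value at x0. *)
Lemma pell_power (P Q D : {poly F}) (d : nat) (s : F) :
    size D = 3 -> P ^+ 2 - D * Q ^+ 2 = 1 -> size P = d.+1 -> (0 < d)%N ->
    s ^+ 2 = D.[0] ->
    let r := lead_coef P / lead_coef Q in
    let x0 := D`_1 / (2 * r ^+ 2) in
    let f := x0 ^+ 2 - D`_0 / r ^+ 2 in
  [/\ r != 0, f != 0
    & (P.[0] + Q.[0] * s) ^+ 2 = ((x0 + s / r) ^+ 2 / f) ^+ d].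
Proof.
move=> szD eqPQ szP d_gt0 sD r x0 f.
have P0 : P != 0 by rewrite -size_poly_gt0 szP.
have D0 : D != 0 by rewrite -size_poly_gt0 szD.
have eqDQ : D * Q ^+ 2 = P ^+ 2 - 1 by rewrite -eqPQ; ring.
have szP2 : size (P ^+ 2) = (2 * d).+1%N.
  by rewrite expr2 size_mulF // szP; lia.
have szDQ : size (D * Q ^+ 2) = (2 * d).+1%N.
  by rewrite eqDQ size_polyDl szP2 // size_polyN size_poly1; lia.
have Q0 : Q != 0.
  apply/eqP => Q0; move: szDQ; rewrite Q0 expr2 mul0r mulr0 size_poly0; lia.
have szQ : size Q = d.
  move: szDQ; rewrite size_mulF ?expf_neq0 // expr2 size_mulF // szD.
  by rewrite -size_poly_gt0 in Q0; lia.
have lP0 : lead_coef P != 0 by rewrite lead_coef_eq0.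
have lQ0 : lead_coef Q != 0 by rewrite lead_coef_eq0.
have r0 : r != 0 by rewrite mulf_neq0 // invr_eq0.
have lD : lead_coef D = r ^+ 2.
  have : lead_coef (D * Q ^+ 2) = lead_coef (P ^+ 2).
    rewrite eqDQ lead_coefDl // szP2 size_polyN size_poly1; lia.
  rewrite lead_coefM !lead_coef_exp /r expr_div_n => <-.
  by rewrite mulfK // expf_neq0.
have DE : D = (r ^+ 2)%:P * (('X + x0%:P) ^+ 2 - f%:P).
  have -> : D = (D`_0)%:P + (D`_1)%:P * 'X + (r ^+ 2)%:P * 'X ^+ 2.
    apply/polyP => i; rewrite !coefD !coefCM coefC coefX coefXn.
    case: i => [|[|[|i]]] /=; rewrite ?mulr0 ?mulr1 ?addr0 ?add0r //.
      by rewrite -lD lead_coefE szD.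
    by rewrite nth_default // szD.
  have -> : D`_0 = r ^+ 2 * (x0 ^+ 2 - f).
    by rewrite /f; field.
  have -> : D`_1 = 2 * r ^+ 2 * x0 by rewrite /x0; field; rewrite r0 pchar0_two.
  by rewrite !(polyCM, polyCB, polyC_exp); ring.
pose L : {poly F} := 'X - x0%:P.
have szL : size L = 2 by rewrite size_XsubC.
have lL : lead_coef L = 1 by rewrite lead_coefXsubC.
pose p : {poly F} := P \Po L; pose q : {poly F} := r%:P * (Q \Po L).
have szp : size p = d.+1 by rewrite size_comp_poly2.
have szq : size q = d by rewrite /q mul_polyC size_scale // size_comp_poly2.
have p0 : p != 0 by rewrite -size_poly_gt0 szp.
have eqpq : p ^+ 2 - ('X ^+ 2 - f%:P) * q ^+ 2 = 1.
  have := congr1 (comp_poly L) eqPQ.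
  rewrite !expr2 comp_polyB !comp_polyM comp_polyC polyC1 => <-.
  congr (_ - _); rewrite DE !expr2 !(comp_polyM, comp_polyB, comp_polyD).
  rewrite !comp_polyC comp_polyX subrK /q (polyCM r r); ring.
(* Otherwise the discriminant is a square, and P + r X Q and P - r X Q, in the
   new variable, are inverse to each other, so that P is constant. *)
have f0 : f != 0.
  apply/eqP => f0; pose a : {poly F} := p - 'X * q.
  pose b : {poly F} := p + 'X * q.
  have eq1 : a * b = 1 by rewrite -eqpq f0 /a /b; ring.
  have /andP[a0 b0] : (a != 0) && (b != 0).
    by rewrite -negb_or -mulf_eq0 eq1 oner_eq0.
  have sz1 : (size a + size b).-1 = 1 by rewrite -size_mulF // eq1 size_poly1.
  rewrite -!size_poly_gt0 in a0 b0.
  have : (size (a + b)%R <= maxn (size a) (size b))%N by exact: size_polyD.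
  have -> : a + b = 2%:P * p by rewrite /a /b; ring.
  by rewrite mul_polyC size_scale ?pchar0_two // szp; lia.
pose R : {poly F} := p - 'X * q.
(* By the choice of r, P and X Q have the same leading term, so their sum has
   degree d, while its product with R has degree at most 2 d - 2. *)
have ltRq : (size R < size q)%N.
  have lpq : lead_coef p = lead_coef q.
    rewrite /q lead_coefM lead_coefC !lead_coef_comp ?szL // lL !expr1n !mulr1.
    by rewrite /r divfK.
  move: lpq; rewrite !lead_coefE szp szq /= => lpq.
  pose b : {poly F} := p + 'X * q.
  have ltdb : (d < size b)%N.
    rewrite ltnNge; apply/negP => /leq_sizeP/(_ d (leqnn d))/eqP.
    rewrite /b coefD coefXM; case: (d) d_gt0 lpq szp => // k _ /= <- szp'.
    apply/negP; rewrite -mulr2n -mulr_natl mulf_neq0 ?pchar0_two //.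
    by have := lead_coef_eq0 p; rewrite lead_coefE szp' (negPf p0) /= => ->.
  have [->|R0] := eqVneq R 0; first by rewrite size_poly0.
  have b0 : b != 0 by rewrite -size_poly_gt0; lia.
  have eqRb : R * b = 1 - f%:P * q ^+ 2 by rewrite -eqpq /R /b; ring.
  have : (size (R * b)%R <= maxn 1 (2 * d).-1)%N.
    rewrite eqRb (leq_trans (size_polyD _ _)) // geq_max size_polyN size_poly1.
    rewrite leq_maxl /= mul_polyC size_scale // leq_max; apply/orP; right.
    by rewrite expr2 mul2n -addnn -szq size_polyMleq.
  by rewrite size_mulF //; move: (size R) (size b) ltdb => i j; lia.
split=> //.
have uv : (x0 + s / r) * (x0 - s / r) = f.
  by rewrite /f -horner_coef0 -sD; field.
have upv : (x0 + s / r) + (x0 - s / r) = 2 * x0 by ring.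
have eqR : R ^+ 2 + 2%:P * 'X * q * R + f%:P * q ^+ 2 = 1%:P.
  by rewrite polyC1 -eqpq /R; ring.
have szq' : size q = d.-1.+1 by rewrite prednK.
have := pell_descent F_char f0 (oner_neq0 F) uv upv eqR ltRq szq'.
rewrite prednK // mul1r.
have -> : R.[x0] + q.[x0] * (x0 + s / r) = P.[0] + Q.[0] * s.
  have Lx0 : L.[x0] = 0 by rewrite /L !hornerE subrr.
  rewrite /R /q /p hornerD hornerN !hornerM hornerX hornerC !horner_comp Lx0.
  by field.
move: uv; set u := x0 + _; set v := x0 - _ => uv eqv.
have v0 : v != 0 by apply: contraNneq f0 => v0; rewrite -uv v0 mulr0.
have v2d : v ^+ (2 * d) != 0 by rewrite expf_neq0.
apply: (mulIf v2d); rewrite [in LHS]mulnC [v ^+ (d * 2)]exprM -exprMn eqv.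
rewrite exprM -exprMn -!uv; congr (_ ^+ d).
have u0 : u != 0 by apply: contraNneq f0 => u0; rewrite -uv u0 mul0r.
by field; rewrite u0 v0.
Qed.

End PolynomialPell.

(** * Parametric solutions from Chebyshev polynomials *)

(** The pair (T_j(M), U_(j-1)(M)) of Chebyshev polynomials of both kinds,
    defined as the coordinates of (M + sqrt(M ^+ 2 - 1)) ^+ j.  The ring is
    arbitrary so that M can be a polynomial or its value at a point. *)
Fixpoint chebyshev (R : comNzRingType) (M : R) (j : nat) : R * R :=
  if j is i.+1 then
    let: (t, u) := chebyshev M i in (M * t + (M ^+ 2 - 1) * u, t + M * u)
  else (1, 0).

Lemma chebyshevS (R : comNzRingType) (M : R) j :
  chebyshev M j.+1 = (M * (chebyshev M j).1 + (M ^+ 2 - 1) * (chebyshev M j).2,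
                      (chebyshev M j).1 + M * (chebyshev M j).2).
Proof. by rewrite /=; case: (chebyshev M j). Qed.

Lemma chebyshev_pell (R : comNzRingType) (M : R) j :
  (chebyshev M j).1 ^+ 2 - (M ^+ 2 - 1) * (chebyshev M j).2 ^+ 2 = 1.
Proof.
elim: j => [|j IHj]; first by rewrite /=; ring.
by rewrite chebyshevS /= -[RHS]IHj; ring.
Qed.

Lemma horner_chebyshev (R : comNzRingType) (M : {poly R}) (c : R) j :
  ((chebyshev M j).1).[c] = (chebyshev M.[c] j).1 /\
  ((chebyshev M j).2).[c] = (chebyshev M.[c] j).2.
Proof.
elim: j => [|j [IH1 IH2]]; first by rewrite /= hornerC horner0.
by rewrite !chebyshevS /= !hornerE IH1 IH2.
Qed.

(** Two consecutive degrees are needed for the three-term recurrence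
    T_(j+2) = 2 M T_(j+1) - T_j, whose first summand dominates. *)
Lemma size_chebyshev (F : fieldType) (M : {poly F}) j :
    [pchar F] =i pred0 -> (1 < size M)%N ->
  size (chebyshev M j).1 = (j * (size M).-1).+1%N.
Proof.
move=> F_char szM.
suff [] : size (chebyshev M j).1 = (j * (size M).-1).+1%N /\
       size (chebyshev M j.+1).1 = (j.+1 * (size M).-1).+1%N by [].
elim: j => [|j [IH1 IH2]].
  split; first by rewrite size_poly1.
  by rewrite chebyshevS /= mulr1 mulr0 addr0 mul1n prednK // ltnW.
split=> //.
have -> : (chebyshev M j.+2).1 = 2%:P * M * (chebyshev M j.+1).1 - (chebyshev M j).1.
  by rewrite !chebyshevS /=; ring.
have M0 : M != 0 by rewrite -size_poly_gt0; lia.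
have T0 : (chebyshev M j.+1).1 != 0 by rewrite -size_poly_gt0 IH2.
have sz : size (2%:P * M * (chebyshev M j.+1).1) = (j.+2 * (size M).-1).+1.
  by rewrite -mulrA mul_polyC size_scale ?pchar0_two // size_mulF // IH2; lia.
by rewrite size_polyDl sz // size_polyN IH1; nia.
Qed.

Lemma parametric_solutionN (R : comNzRingType) (n a b : R) (P Q D : {poly R}) :
  parametric_solution n a b P Q D ->
  parametric_solution n (- a) (- b) (- P) (- Q) D.
Proof. by case=> szD eqPQ Pa Qb Dn; split; rewrite ?hornerN ?Pa ?Qb ?sqrrN. Qed.

(** The substitution M = X + x realises each power of x + y sqrt n with its own
    exponent as degree. *)
Lemma parametric_linear (n x y : rat) (d : nat) :
    x ^+ 2 - n * y ^+ 2 = 1 -> y != 0 ->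
  exists P Q D, parametric_solution n (chebyshev x d).1 (y * (chebyshev x d).2) P Q D
    /\ size P = d.+1.
Proof.
move=> xy y0; pose M : {poly rat} := 'X + x%:P.
have szM : size M = 2 by rewrite size_XaddC.
have M0 : M.[0] = x by rewrite /M !hornerE.
exists (chebyshev M d).1, (y%:P * (chebyshev M d).2), ((y ^- 2)%:P * (M ^+ 2 - 1)).
split; last by rewrite size_chebyshev ?szM ?muln1 //; exact: pchar_num.
have [T0 S0] := horner_chebyshev M 0 d.
split.
- rewrite mul_polyC size_scale ?invr_eq0 ?expf_neq0 //.
  have szM2 : size (M ^+ 2) = 3.
    by rewrite expr2 size_mulF ?szM // -size_poly_gt0 szM.
  by rewrite size_polyDl szM2 // size_polyN size_poly1.
- rewrite exprMn mulrACA -polyC_exp -polyCM mulVf ?expf_neq0 // mul1r.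
  exact: chebyshev_pell.
- by rewrite T0 M0.
- by rewrite hornerM hornerC S0 M0.
rewrite hornerM !hornerC hornerD hornerN horner_exp M0 -polyC1 hornerC.
apply: (mulfI (expf_neq0 2 y0)).
by rewrite mulVKf ?expf_neq0 //; lra.
Qed.

(** The linear construction for a square root of x + y sqrt n, with exponent
    2 e.  It uses the linear polynomial L = l (X + 1) with
    l ^+ 2 = (x + 1) / 2, and l need not be rational; but as
    T_(2 e)(L) = T_e(2 L ^+ 2 - 1), only M = 2 L ^+ 2 - 1 occurs. *)
Lemma parametric_quadratic (n x y : rat) (e : nat) :
    x ^+ 2 - n * y ^+ 2 = 1 -> y != 0 -> x + 1 != 0 ->
  exists P Q D, parametric_solution n (chebyshev x e).1 (y * (chebyshev x e).2) P Q D
    /\ size P = (2 * e).+1.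
Proof.
move=> xy y0 x1; pose L : {poly rat} := 'X + 1.
pose M : {poly rat} := (x + 1)%:P * L ^+ 2 - 1.
have szL : size L = 2 by rewrite /L -polyC1 size_XaddC.
have L0 : L.[0] = 1 by rewrite /L !hornerE.
have szL2 : size ((x + 1)%:P * L ^+ 2) = 3.
  by rewrite mul_polyC size_scale // expr2 size_mulF ?szL // -size_poly_gt0 szL.
have szM : size M = 3.
  by rewrite size_polyDl szL2 // size_polyN size_poly1.
have M0 : M.[0] = x.
  by rewrite /M hornerD hornerM hornerN horner_exp L0 -polyC1 !hornerC; ring.
exists (chebyshev M e).1, (y%:P * L * (chebyshev M e).2).
exists (((x + 1) / y ^+ 2)%:P * (M - 1)).
split; last by rewrite size_chebyshev ?szM 1?mulnC //; exact: pchar_num.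
have [T0 S0] := horner_chebyshev M 0 e.
split.
- rewrite mul_polyC size_scale ?mulf_neq0 ?invr_eq0 ?expf_neq0 //.
  by rewrite size_polyDl szM // size_polyN size_poly1.
- rewrite -[RHS](chebyshev_pell M e); congr (_ - _).
  (* Of the two factors of M ^+ 2 - 1 = (M - 1) (M + 1), the second is a
     constant times a square: the constant goes to D, the square to Q. *)
  have ME : ((x + 1) / y ^+ 2)%:P * (y%:P * L) ^+ 2 = M + 1.
    rewrite exprMn mulrA -polyC_exp -polyCM divfK ?expf_neq0 // /M; ring.
  rewrite exprMn; move: ME; set c := (_ / _)%:P; set l := _ ^+ 2; move=> ME.
  transitivity (c * l * (M - 1) * (chebyshev M e).2 ^+ 2); first by ring.
  by rewrite ME; ring.
- by rewrite T0 M0.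
- by rewrite !hornerM hornerC L0 mulr1 S0 M0.
rewrite hornerM hornerC hornerD hornerN M0 -polyC1 hornerC.
apply: (mulfI (expf_neq0 2 y0)).
have -> : y ^+ 2 * ((x + 1) / y ^+ 2 * (x - 1)) = x ^+ 2 - 1 by field.
by lra.
Qed.

(** The coefficient of X ^+ i is multiplied by the i-th power of a multiple of
    the denominator m, so only the constant coefficient must be integral
    beforehand.  The spare factor m' lets several polynomials share one
    substitution. *)
Lemma integral_rescaling (p : {poly rat}) (c m m' : int) (r : {poly int}) :
    p.[0] = c%:~R -> m != 0 -> p = m%:~R^-1 *: map_poly intr r ->
  exists q : {poly int},
    p \Po ((m * m')%:~R *: 'X) = map_poly (intr : int -> rat) q.
Proof.
move=> p0 m0 pr.
exists (\poly_(i < size p) (if i is i'.+1 then (m * m') ^+ i' * m' * r`_i else c)).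
apply/polyP => i; rewrite coef_map coef_poly.
have -> : (p \Po ((m * m')%:~R *: 'X))`_i = p`_i * (m * m')%:~R ^+ i.
  rewrite comp_polyE (eq_bigr (fun j : 'I_ _ => (p`_j * (m * m')%:~R ^+ j) *: 'X^j)).
    rewrite -(poly_def (size p) (fun j => p`_j * _ ^+ j)) coef_poly.
    by case: ltnP => // /(nth_default 0) ->; rewrite mul0r.
  by move=> j _; rewrite exprZn scalerA.
case: ltnP => [_|/(nth_default 0) ->]; last by rewrite mul0r.
case: i => [|i]; first by rewrite expr0 mulr1 -horner_coef0.
rewrite pr coefZ coef_map /= !(rmorphM, rmorphXn) /=.
by rewrite exprS; field; rewrite intr_eq0.
Qed.

Lemma parametric_solution_int (n a b : int) (P Q D : {poly rat}) :
    parametric_solution n%:~R a%:~R b%:~R P Q D ->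
  exists P' Q' D' : {poly int},
    parametric_solution n a b P' Q' D' /\ size P' = size P.
Proof.
move=> [szD eqPQ Pa Qb Dn].
have [rP [mP mP0 PE]] := rat_poly_scale P.
have [rQ [mQ mQ0 QE]] := rat_poly_scale Q.
have [rD [mD mD0 DE]] := rat_poly_scale D.
pose N := mP * (mQ * mD).
have N0 : N != 0 by rewrite !mulf_neq0.
have [P' P'E] := integral_rescaling (mQ * mD) Pa mP0 PE.
have [Q' Q'E] := integral_rescaling (mP * mD) Qb mQ0 QE.
have [D' D'E] := integral_rescaling (mP * mQ) Dn mD0 DE.
have NQ : mQ * (mP * mD) = N by rewrite /N; ring.
have ND : mD * (mP * mQ) = N by rewrite /N; ring.
rewrite -/N in P'E; rewrite NQ in Q'E; rewrite ND in D'E.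
have szX : size (N%:~R *: 'X : {poly rat}) = 2.
  by rewrite size_scale ?intr_eq0 // size_polyX.
have X0 : (N%:~R *: 'X : {poly rat}).[0] = 0 by rewrite !hornerE.
have szE (p : {poly rat}) (q : {poly int}) :
    p \Po (N%:~R *: 'X) = map_poly intr q -> size q = size p.
  move=> pq; rewrite -(size_comp_poly2 p szX) pq.
  by rewrite size_map_inj_poly //; exact: intr_inj.
have hornerEq (p : {poly rat}) (q : {poly int}) (c : int) :
    p \Po (N%:~R *: 'X) = map_poly intr q -> p.[0] = c%:~R -> q.[0] = c.
  move=> pq pc; apply: (@intr_inj rat); rewrite -pc -[in RHS]X0 -horner_comp pq.
  by rewrite -[0 in RHS](rmorph0 intr) horner_map.
exists P', Q', D'; split; last exact: szE P'E.
split; [by rewrite (szE _ _ D'E) | | exact: hornerEq P'E Pa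
       | exact: hornerEq Q'E Qb | exact: hornerEq D'E Dn].
apply: (map_inj_poly (@intr_inj rat) (rmorph0 _)).
rewrite !expr2 rmorphB !rmorphM /= -P'E -Q'E -D'E.
have := congr1 (comp_poly (N%:~R *: 'X)) eqPQ.
by rewrite comp_polyB !expr2 !comp_polyM comp_polyC polyC1 => ->; rewrite rmorph1.
Qed.

(** * Coordinates in a quadratic field *)

Section Quadratic.
Variables (n : int) (K : splittingFieldType rat) (s : K).
Hypotheses (n_nonsquare : ~ exists m : int, n = m ^+ 2).
Hypothesis K_s : is_quadratic_field n s.

Lemma rat_alg_int (m : int) : (m%:~R)%:A = m%:~R :> K.
Proof. exact: (rmorph_int (in_alg K)). Qed.

(** The integers are integrally closed.  The integrality transfers from K to
    algC, since the polynomial has integral coefficients and the root is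
    rational. *)
Lemma integral_rat (x : rat) :
  integralOver (intr : int -> K) x%:A -> exists m : int, x = m%:~R.
Proof.
move=> [p p_monic px].
have intr_comp (L : fieldType) (g : {rmorphism rat -> L}) :
    map_poly intr p = map_poly g (map_poly intr p).
  by rewrite -map_poly_comp; apply: eq_map_poly => m /=; rewrite rmorph_int.
have px' : root (map_poly (intr : int -> rat) p) x.
  by move: px; rewrite (intr_comp _ (in_alg K)) fmorph_root.
have : (ratr x : algC) \in Aint.
  apply: (@root_monic_Aint (map_poly intr p)).
  - by rewrite (intr_comp _ (@ratr algC)) fmorph_root.
  - exact: monic_map.
  - by apply/polyOverP => i; rewrite coef_map /= rpred_int.
move=> /(Cint_rat_Aint (Crat_rat x)) /intrP[m xm]; exists m.
by apply: (fmorph_inj (@ratr algC)); rewrite [LHS]xm [RHS]ratr_int.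
Qed.

Lemma sqrt_n : s ^+ 2 = (n%:~R)%:A.
Proof. by rewrite rat_alg_int; case: K_s. Qed.

Lemma sqrt_n_integral : integralOver (intr : int -> K) s.
Proof.
exists ('X^2 - n%:P); first by rewrite monicXnsubC.
by rewrite rmorphB /= map_polyXn map_polyC /= rootE !hornerE (proj1 K_s) subrr.
Qed.

Lemma sqrt_n_irrational (x : rat) : s != x%:A.
Proof.
apply/eqP => sx; have := sqrt_n_integral; rewrite sx => /integral_rat[m xm].
apply: n_nonsquare; exists m; have := sqrt_n.
rewrite sx xm -(rmorphXn (in_alg K)) => /(fmorph_inj (in_alg K)).
by rewrite -rmorphXn => /intr_inj.
Qed.

Lemma sqrt_n_notin1 : s \notin 1%VS.
Proof. by apply/vlineP => -[x sx]; move: (sqrt_n_irrational x); rewrite sx eqxx. Qed.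

Lemma adjoin_sqrt_n : adjoin_degree 1 s = 2.
Proof.
apply/eqP; rewrite eqn_leq; apply/andP; split; last first.
  rewrite ltn_neqAle eq_sym adjoin_deg_eq1 sqrt_n_notin1 /=.
  by rewrite -ltnS -(size_minPoly 1 s) (size_minPoly 1 s).
rewrite -ltnS -(size_minPoly 1 s) -(size_XnsubC (n%:~R : K) (isT : (0 < 2)%N)).
apply: dvdp_leq; first by rewrite monic_neq0 // monicXnsubC.
apply: minPoly_dvdp.
  by rewrite rpredB ?rpredX ?polyOverX ?polyOverC //= rpred_int.
by rewrite rootE !hornerE (proj1 K_s) subrr.
Qed.

Definition quad (x y : rat) : K := x%:A + y *: s.

Lemma quadP (u : K) : exists x y, u = quad x y.
Proof.
have uE := Fadjoin_poly_eq (_ : u \in <<1; s>>%VS).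
rewrite -uE; last by rewrite (proj2 K_s) memvf.
have := size_Fadjoin_poly 1 s u; rewrite adjoin_sqrt_n => sz2.
have /polyOverP p1 := Fadjoin_polyOver 1 s u.
have /vlineP[x x0] := p1 0; have /vlineP[y y0] := p1 1.
exists x, y; rewrite (horner_coef_wide _ sz2) !big_ord_recl big_ord0 /=.
by rewrite addr0 x0 y0 expr0 mulr1 expr1 -scalerAl mul1r.
Qed.

Lemma quadM x y x' y' :
  quad x y * quad x' y' = quad (x * x' + n%:~R * (y * y')) (x * y' + x' * y).
Proof.
rewrite /quad mulrDl !mulrDr -!scalerAl -!scalerAr !mul1r !mulr1 !scalerA.
rewrite -expr2 sqrt_n !scalerA scalerDl scalerDl [y * x']mulrC.
rewrite [y * y' * _]mulrC.
rewrite -!addrA; congr (_ + _).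
by rewrite addrA addrC.
Qed.

Lemma quad_inj x y x' y' : quad x y = quad x' y' -> x = x' /\ y = y'.
Proof.
move=> /eqP; rewrite -subr_eq0 /quad opprD addrACA -!scalerBl => /eqP e.
have yy : y - y' = 0.
  apply/eqP; apply: contraT => yy; move: (sqrt_n_irrational (- (x - x') / (y - y'))).
  case/eqP; apply: (scalerI yy); rewrite scalerA mulrC divfK //.
  by rewrite scaleNr; apply/eqP; rewrite -addr_eq0 addrC e.
move: e; rewrite yy scale0r addr0 => /eqP; rewrite scaler_eq0 oner_eq0 orbF.
by move=> /eqP xx; split; apply/eqP; rewrite -subr_eq0 ?xx ?yy.
Qed.

Lemma quad_intE (a b : int) : a%:~R + b%:~R * s = quad a%:~R b%:~R.
Proof. by rewrite /quad rat_alg_int -[in RHS](mul1r s) scalerAl rat_alg_int. Qed.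

Lemma quadN x y : - quad x y = quad (- x) (- y).
Proof. by rewrite /quad !scaleNr opprD. Qed.

Lemma quad10 : quad 1 0 = 1.
Proof. by rewrite /quad scale0r addr0 scale1r. Qed.

(** The Galois group has order 2, and a nontrivial automorphism must move the
    generator s to the other square root of n. *)
Lemma quadratic_conjugation :
  exists2 tau : {rmorphism K -> K}, forall x y, tau (quad x y) = quad x (- y)
    & forall u, galNorm 1 {:K} u = u * tau u.
Proof.
have K_gal : galois 1 {:K}.
  rewrite /galois sub1v normalFieldf andbT /=.
  apply/separableP => u _; apply: pcharf0_separable => p.
  by rewrite (pchar_lalg K) pchar_num.
have cardG : #|'Gal({:K} / 1)%g| = 2.
  rewrite -(galois_dim K_gal) -adjoin_sqrt_n adjoin_degreeE.
  by rewrite (proj2 K_s).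
have [g gG g1] : exists2 g, g \in 'Gal({:K} / 1)%g & g != 1%g.
  have : (1 < #|'Gal({:K} / 1)%g|)%N by rewrite cardG.
  by rewrite cardG_gt1 => /trivgPn[g gG g1]; exists g.
have GE : 'Gal({:K} / 1)%g = [set 1%g; g].
  apply/eqP; rewrite eq_sym eqEcard cards2 cardG eq_sym g1 andbT.
  by apply/fintype.subsetP => h; rewrite !inE => /orP[/eqP->|/eqP->] //; rewrite group1.
have gs : g s = - s.
  have : (g s - s) * (g s + s) = 0.
    rewrite -subr_sqr -rmorphXn (proj1 K_s) rmorph_int subrr //.
  move/eqP; rewrite mulf_eq0 subr_eq0 addr_eq0 => /orP[/eqP gs|/eqP //].
  case/negP: g1; apply/gal_eqP => u _; rewrite gal_id.
  have [x [y ->]] := quadP u; rewrite /quad linearD /= !linearZ /= gs.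
  by rewrite rmorph1.
have gE x y : g (quad x y) = quad x (- y).
  by rewrite /quad linearD /= !linearZ /= gs rmorph1 scalerN scaleNr.
exists (g : {rmorphism K -> K}) => //.
move=> u; rewrite /galNorm GE big_setU1 ?inE 1?eq_sym // big_set1.
by rewrite gal_id.
Qed.

Lemma quad_norm x y : quad x y * quad x (- y) = (x ^+ 2 - n%:~R * y ^+ 2)%:A.
Proof.
rewrite quadM /quad !mulrN addNr scale0r addr0; congr (_ *: _); ring.
Qed.

Lemma quadV x y : x ^+ 2 - n%:~R * y ^+ 2 = 1 -> quad x (- y) = (quad x y)^-1.
Proof.
move=> xy; have uu : quad x y * quad x (- y) = 1 by rewrite quad_norm xy scale1r.
have u0 : quad x y != 0.
  by apply: contra_eq_neq uu => ->; rewrite mul0r eq_sym oner_eq0.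
by rewrite -[LHS](mulKf u0) uu mulr1.
Qed.

Lemma galNorm_quad x y : galNorm 1 {:K} (quad x y) = (x ^+ 2 - n%:~R * y ^+ 2)%:A.
Proof. by have [tau tauE ->] := quadratic_conjugation; rewrite tauE quad_norm. Qed.

Lemma quad_integral (x y : rat) (t : int) :
  x ^+ 2 - n%:~R * y ^+ 2 = 1 -> 2 * x = t%:~R ->
  integralOver (intr : int -> K) (quad x y).
Proof.
move=> xy xt; exists ('X * ('X - t%:P) + 1).
  rewrite monicE lead_coefDl; first by rewrite lead_coefM lead_coefX lead_coefXsubC.
  by rewrite mulrC size_mulX ?polyXsubC_eq0 // size_XsubC size_poly1.
rewrite rmorphD rmorphM rmorphB rmorph1 /= map_polyX map_polyC /=.
rewrite rootE !hornerE -(rat_alg_int t) -xt.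
have -> : quad x y - (2 * x)%:A = - quad x (- y).
  rewrite /quad addrAC -scalerBl opprD -!scaleNr opprK; congr (_ *: _ + _); ring.
by rewrite mulrN quad_norm xy scale1r addNr.
Qed.

(** For an element of norm one, integrality is integrality of the trace 2 x,
    because it is a root of X ^+ 2 - (2 x) X + 1.  No condition on y is left:
    its denominator depends on the square factors of n. *)
Lemma norm_one_unitsP x y :
  norm_one_units (quad x y) <->
  x ^+ 2 - n%:~R * y ^+ 2 = 1 /\ exists t : int, 2 * x = t%:~R.
Proof.
rewrite /norm_one_units /= galNorm_quad; split.
  move=> [[u0 intu _] /eqP]; rewrite -[X in _ == X](scale1r (1 : K)).
  rewrite -subr_eq0 -scalerBl scaler_eq0 oner_eq0 orbF subr_eq0 => /eqP xy.
  split=> //; apply: integral_rat.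
  have [tau tauE _] := quadratic_conjugation.
  have -> : (2 * x)%:A = quad x y + tau (quad x y).
    rewrite tauE /quad addrACA -!scalerDl subrr scale0r addr0.
    by congr (_ *: _); ring.
  apply: integral_add => //.
  case: intu => p p_monic pu; exists p => //.
  have -> : map_poly intr p = map_poly tau (map_poly (intr : int -> K) p).
    by rewrite -map_poly_comp; apply: eq_map_poly => m /=; rewrite rmorph_int.
  by rewrite fmorph_root.
move=> [xy [t xt]]; rewrite xy scale1r; split=> //.
have uu : quad x y * quad x (- y) = 1 by rewrite quad_norm xy scale1r.
have u0 : quad x y != 0.
  by apply: contra_eq_neq uu => ->; rewrite mul0r eq_sym oner_eq0.
split=> //; first exact: quad_integral xt.
by rewrite -quadV //; apply: quad_integral xt; rewrite sqrrN.
Qed.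

(** * The group of norm one units of a real quadratic field *)

Lemma norm_one_unitsM u v :
  @norm_one_units K u -> norm_one_units v -> norm_one_units (u * v).
Proof.
move=> [[u0 iu iVu] nu] [[v0 iv iVv] nv]; split; last by rewrite galNormM nu nv mulr1.
split; first exact: mulf_neq0.
  exact: integral_mul.
by rewrite invfM; apply: integral_mul.
Qed.

Hypothesis n_gt0 : 0 < n.

Let N : rat := n%:~R.
Let N_gt0 : 0 < N. Proof. by rewrite ltr0z. Qed.

Lemma lt_of_sqr (R : realDomainType) (a b : R) : 0 <= b -> a ^+ 2 < b ^+ 2 -> a < b.
Proof. by move=> b0 ab; rewrite ltNge; apply/negP => ba; nra. Qed.

Lemma le_of_sqr (R : realDomainType) (a b : R) : 0 <= b -> a ^+ 2 <= b ^+ 2 -> a <= b.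
Proof. by move=> b0 ab; rewrite leNgt; apply/negP => ba; nra. Qed.

(** The numbers in the conclusion are the coordinates of the quotient of
    x + y sqrt n by p + q sqrt n.  Since y and q grow with x and p, dividing by
    a smaller element of the first quadrant keeps the element in it and lowers
    its trace.  All three inequalities are proved between squares, where the
    norm equations eliminate y and q. *)
Lemma pell_quotient (p q x y : rat) :
    p ^+ 2 - N * q ^+ 2 = 1 -> x ^+ 2 - N * y ^+ 2 = 1 ->
    1 < p -> 0 < q -> p <= x -> 0 < y ->
  [/\ 0 < x * p - N * (y * q), x * p - N * (y * q) < x & 0 <= y * p - x * q].
Proof.
move=> pq xy p1 q0 px y0.
have NqE : N * q ^+ 2 = p ^+ 2 - 1 by rewrite -pq; ring.
have NyE : N * y ^+ 2 = x ^+ 2 - 1 by rewrite -xy; ring.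
have NyqE : (N * (y * q)) ^+ 2 = (x ^+ 2 - 1) * (p ^+ 2 - 1).
  by rewrite -NqE -NyE; ring.
have Nyq0 : 0 < N * (y * q) by rewrite !mulr_gt0.
split.
- rewrite subr_gt0; apply: lt_of_sqr; first nra.
  by rewrite NyqE; nra.
- rewrite ltrBlDl -ltrBlDr.
  apply: lt_of_sqr; first exact: ltW.
  have -> : x * p - x = x * (p - 1) by ring.
  rewrite NyqE -subr_gt0.
  have -> : (x ^+ 2 - 1) * (p ^+ 2 - 1) - (x * (p - 1)) ^+ 2
     = (p - 1) * (2 * x ^+ 2 - p - 1) by ring.
  by apply: mulr_gt0; nra.
- rewrite subr_ge0; apply: le_of_sqr; first nra.
  rewrite -(ler_pM2l N_gt0).
  have -> : N * (x * q) ^+ 2 = x ^+ 2 * (p ^+ 2 - 1) by rewrite -NqE; ring.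
  have -> : N * (y * p) ^+ 2 = (x ^+ 2 - 1) * p ^+ 2 by rewrite -NyE; ring.
  nra.
Qed.

(** Equivalently, the norm one units that are greater than 1 in the embedding of
    K that makes s positive; this form uses rational coordinates only. *)
Definition positive_unit (x y : rat) : Prop :=
  [/\ norm_one_units (quad x y), 1 < x & 0 < y].

Lemma positive_unitM x y x' y' : positive_unit x y -> positive_unit x' y' ->
  positive_unit (x * x' + N * (y * y')) (x * y' + x' * y).
Proof.
move=> [u x1 y0] [u' x1' y0']; split.
- by rewrite -quadM; apply: norm_one_unitsM.
- by have := mulr_gt0 N_gt0 (mulr_gt0 y0 y0'); nra.
- by rewrite addr_gt0 ?mulr_gt0 //; lra.
Qed.

Lemma positive_unitX x y k : positive_unit x y ->
  exists x' y', positive_unit x' y' /\ quad x y ^+ k.+1 = quad x' y'.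
Proof.
move=> xy; elim: k => [|k [x' [y' [xy' IHk]]]]; first by exists x, y.
rewrite exprS IHk quadM; do 2!eexists; split; last by [].
exact: positive_unitM.
Qed.

Lemma positive_unit_free x y (k : int) :
  positive_unit x y -> (quad x y ^ k) ^+ 2 = 1 -> k = 0.
Proof.
move=> xy.
have pow_neq1 (j : nat) : (quad x y ^+ j.+1) ^+ 2 <> 1.
  rewrite -exprM mulnC; have [x' [y' [[_ _ y0] ->]]] := positive_unitX (2 * j.+1).-1 xy.
  by rewrite -quad10 => /quad_inj[_ y'0]; rewrite y'0 ltxx in y0.
case: k => [[//|j] /pow_neq1 //|j]; rewrite NegzE -invr_expz exprVn.
by move=> /eqP; rewrite invr_eq1 => /eqP /pow_neq1.
Qed.

(** The traces 2 x are natural numbers, so they have a least element. *)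
Lemma fundamental_unit (x0 y0 : rat) : positive_unit x0 y0 ->
  exists p q, positive_unit p q /\
    forall x y, positive_unit x y -> p <= x.
Proof.
move=> xy0.
pose P (t : nat) := `[< exists x y, positive_unit x y /\ 2 * x = t%:R >].
have trace_nat x y : positive_unit x y -> exists t : nat, 2 * x = t%:R.
  move=> [/norm_one_unitsP[_ [t xt]] x1 _]; exists `|t|%N.
  rewrite xt pmulrn; congr (_%:~R); rewrite gez0_abs //.
  by rewrite -(ler0z rat) -xt; lra.
have exP : exists t, P t.
  have [t xt] := trace_nat _ _ xy0.
  by exists t; apply/asboolP; exists x0, y0.
case: (ex_minnP exP) => t /asboolP[p [q [pq pt]]] minP; exists p, q; split=> // x y xy.
have [t' xt'] := trace_nat _ _ xy.
have /minP : P t' by apply/asboolP; exists x, y.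
by rewrite -(ler_nat rat) -pt -xt'; lra.
Qed.

(** Induction on a bound m for the trace: unless x + y s is 1, its quotient by
    the fundamental unit is again in the closed first quadrant, and the trace,
    an integer, has dropped by at least 1. *)
Lemma fundamental_unit_descent p q :
    positive_unit p q -> (forall x y, positive_unit x y -> p <= x) ->
  forall (m : nat) x y, norm_one_units (quad x y) -> 1 <= x -> 0 <= y ->
    2 * x <= m%:R -> exists k : nat, quad x y = quad p q ^+ k.
Proof.
move=> pq pmin; have [pqU p1 q0] := pq.
have /norm_one_unitsP[pqN _] := pqU.
elim=> [|m IHm] x y xyU x1 y0 xm; first by move: xm; lra.
have /norm_one_unitsP[xyN _] := xyU.
have [y_eq0|y_neq0] := eqVneq y 0.
  exists 0%N; rewrite y_eq0 expr0 -quad10; congr quad.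
  by move: xyN; rewrite y_eq0 => xN; nra.
have y_gt0 : 0 < y by rewrite lt_def y_neq0.
have x_gt1 : 1 < x.
  by have := mulr_gt0 N_gt0 (exprn_gt0 2 y_gt0); nra.
have xy : positive_unit x y by [].
have [x'0 x'x y'0] := pell_quotient pqN xyN p1 q0 (pmin _ _ xy) y_gt0.
set x' := x * p - _ in x'0 x'x; set y' := y * p - _ in y'0.
have quotE : quad x y / quad p q = quad x' y'.
  by rewrite -quadV // quadM; congr quad; rewrite /x' /y' /N; ring.
have x'y'U : norm_one_units (quad x' y').
  rewrite -quotE -quadV //; apply: norm_one_unitsM => //.
  by apply/norm_one_unitsP; rewrite sqrrN; apply/norm_one_unitsP.
have h0 : quad p q != 0 by case: pqU => -[].
have /norm_one_unitsP[x'y'N [t' xt']] := x'y'U.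
have /norm_one_unitsP[_ [t xt]] := xyU.
have [k kE] : exists k : nat, quad x' y' = quad p q ^+ k.
  apply: IHm => //; first by have := mulr_ge0 (ltW N_gt0) (sqr_ge0 y'); nra.
  rewrite xt'; move: xm; rewrite xt !pmulrn !ler_int.
  have : t' < t by rewrite -(ltr_int rat) -xt -xt'; lra.
  by lia.
by exists k.+1; rewrite exprSr -kE -quotE divfK.
Qed.

(** The signs of the coordinates are normalised by negation and inversion,
    which act on them by (-x, -y) and (x, -y). *)
Lemma fundamental_unit_generates p q :
    positive_unit p q -> (forall x y, positive_unit x y -> p <= x) ->
  forall u, norm_one_units u <-> signed_powers (quad p q) 1 u.
Proof.
move=> pq pmin u; have [pqU p1 q0] := pq; split; last first.
  move=> [e [k ->]].
  have hX (j : nat) : norm_one_units (quad p q ^+ j).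
    case: j => [|j]; last by have [x [y [[]]]] := positive_unitX j pq => ? ? ? ->.
    rewrite expr0 -quad10; apply/norm_one_unitsP; split; first by ring.
    by exists 2; rewrite mulr1.
  have hXz : norm_one_units (quad p q ^ (1%:Z * k)).
    rewrite mul1r; case: k => j; first exact: hX.
    have [x [y hE]] := quadP (quad p q ^+ j.+1).
    have := hX j.+1; rewrite NegzE -invr_expz hE => hU.
    have /norm_one_unitsP[xyN xt] := hU; rewrite -[quad p q ^ _]/(quad p q ^+ j.+1) hE.
    by rewrite -quadV //; apply/norm_one_unitsP; rewrite sqrrN.
  apply: norm_one_unitsM => //; case: e; last exact: (hX 0%N).
  rewrite expr1 -quad10 quadN oppr0; apply/norm_one_unitsP; split; first by ring.
  by exists (- 2); rewrite mulrN1.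
have [x [y ->]] := quadP u; move=> xyU.
have /norm_one_unitsP[xyN [t xt]] := xyU.
have absU : norm_one_units (quad `|x| `|y|).
  apply/norm_one_unitsP; rewrite !real_normK ?num_real //; split=> //.
  exists `|t|; rewrite intr_norm -xt normrM; congr (_ * _).
have x1 : 1 <= `|x|.
  have : 1 <= `|x| ^+ 2.
    rewrite real_normK ?num_real //.
    by have := mulr_ge0 (ltW N_gt0) (sqr_ge0 y); lra.
  by have := normr_ge0 x; nra.
have [k kE] : exists k : nat, quad `|x| `|y| = quad p q ^+ k.
  apply: (fundamental_unit_descent pq pmin (m := `|t|%N)) => //.
  rewrite pmulrn; suff -> : 2 * `|x| = `|t|%:~R by [].
  by rewrite intr_norm -xt normrM.
have absV : quad `|x| (- `|y|) = quad p q ^ (- k%:Z).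
  by rewrite quadV ?kE -?invr_expz //; case/norm_one_unitsP: absU.
have [x0|x0] := ler0P x; have [y0|y0] := ler0P y.
- exists true, k%:Z; rewrite mul1r -[quad p q ^ _]/(quad p q ^+ k) -kE mulN1r.
  by rewrite quadN !ler0_norm // !opprK.
- exists true, (- k%:Z); rewrite mul1r -absV mulN1r.
  by rewrite quadN opprK ler0_norm // gtr0_norm // opprK.
- exists false, (- k%:Z); rewrite !mul1r -absV.
  by rewrite gtr0_norm // ler0_norm // opprK.
exists false, k%:Z; rewrite !mul1r -[quad p q ^ _]/(quad p q ^+ k) -kE.
by rewrite !gtr0_norm.
Qed.

Lemma quad_exp x y j : x ^+ 2 - N * y ^+ 2 = 1 ->
  quad x y ^+ j = quad (chebyshev x j).1 (y * (chebyshev x j).2).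
Proof.
move=> xy; elim: j => [|j IHj]; first by rewrite expr0 mulr0 quad10.
rewrite exprS IHj quadM chebyshevS /= -/N.
have -> : x ^+ 2 - 1 = N * y ^+ 2 by rewrite -xy; ring.
by congr quad; ring.
Qed.

Lemma pell_solution_unit a b : pell_solution n a b ->
  norm_one_units (quad a%:~R b%:~R).
Proof.
move=> ab; apply/norm_one_unitsP; split; last by exists (2 * a); rewrite rmorphM.
by rewrite -!rmorphXn -rmorphM -rmorphB ab.
Qed.

(** Here h is the fundamental unit or its inverse, chosen to make the exponent m
    positive; m is not 0 because b <> 0. *)
Lemma pell_solution_power a b : pell_solution n a b -> b <> 0 ->
  exists (h : K) (m : nat) (e : bool),
    [/\ h != 0, forall u, norm_one_units u <-> signed_powers h 1 u,
        forall k : int, (h ^ k) ^+ 2 = 1 -> k = 0, (0 < m)%N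
      & a%:~R + b%:~R * s = (-1) ^+ e * h ^+ m].
Proof.
move=> ab b0.
have abU := pell_solution_unit ab.
have absE : positive_unit `|a%:~R| `|b%:~R|.
  have := pell_solution_unit (a := `|a|) (b := `|b|) _.
  rewrite /pell_solution !real_normK ?num_real // => /(_ ab).
  rewrite !intr_norm => absU.
  have b_gt0 : 0 < `|b%:~R : rat| by rewrite normr_gt0 intr_eq0; apply/eqP.
  split=> //.
  have /norm_one_unitsP[absN _] := absU.
  by have := mulr_gt0 N_gt0 (exprn_gt0 2 b_gt0); have := normr_ge0 (a%:~R : rat); nra.
have [p [q [pq pmin]]] := fundamental_unit absE.
have hP := fundamental_unit_generates pq pmin.
have h0 : quad p q != 0 by case: pq => -[[]].
have hfree k := @positive_unit_free p q k pq.
have /hP [e [k abE]] := abU; rewrite mul1r in abE; rewrite quad_intE.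
case: k => m in abE.
  exists (quad p q), m, e; split=> //; case: m abE => [|//].
  rewrite expr0z mulr1 => abE.
  suff : (b%:~R : rat) = 0 by move/eqP; rewrite intr_eq0 => /eqP.
  by case: e abE; rewrite ?expr1 ?expr0 -quad10 ?quadN ?oppr0 => /quad_inj[_ ->].
exists (quad p q)^-1, m.+1, e; split=> //.
- by rewrite invr_eq0.
- move=> u; rewrite hP; split=> -[e' [k ->]]; exists e', (- k);
    by rewrite exprz_inv !mul1r ?opprK.
- move=> k; rewrite exprz_inv => /hfree /eqP; rewrite oppr_eq0 => /eqP //.
by rewrite abE NegzE -exprz_inv.
Qed.

Lemma norm_one_units_root u d : (0 < d)%N -> galNorm 1 {:K} u = 1 ->
  norm_one_units (u ^+ d) -> norm_one_units u.
Proof.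
move=> d_gt0 nu [[ud0 iud iVud] _].
have root_int v : integralOver (intr : int -> K) (v ^+ d) ->
    integralOver (intr : int -> K) v.
  move=> ivd; apply: (@integral_root_monic _ _ _ _ ('X^d - (v ^+ d)%:P)).
  - exact: monicXnsubC.
  - by rewrite rootE !hornerE subrr.
  apply/integral_poly => i; rewrite coefB coefXn coefC.
  apply: integral_sub; first exact: integral_nat.
  by case: ifP => // _; apply: integral0.
split=> //; split; [|exact: root_int|by apply: root_int; rewrite exprVn].
by apply: contraNneq ud0 => ->; rewrite expr0n eqn0Ngt d_gt0.
Qed.

(** * Parametric solutions and powers of units *)

(** The element z is the value at 0 of the w ^+ 2 / f given by [pell_power].  Its
    ingredients r, x0 and f are rational, being fixed by conjugation, so the
    norm of z is (f / f) ^+ 2 = 1. *)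
Lemma parametric_solution_unit a b (P Q D : {poly int}) d : (0 < d)%N ->
    pell_solution n a b -> parametric_solution n a b P Q D -> size P = d.+1 ->
  exists2 z, norm_one_units z & (a%:~R + b%:~R * s) ^+ 2 = z ^+ d.
Proof.
move=> d_gt0 ab [szD eqPQ Pa Qb Dn] szP.
have K_char : [pchar K] =i pred0 by move=> p; rewrite (pchar_lalg K) pchar_num.
have intK_inj : injective (intr : int -> K).
  by move=> x y; rewrite -!rat_alg_int => /(fmorph_inj (in_alg K)) /intr_inj.
pose toK := map_poly (intr : int -> K).
have sz p : size (toK p) = size p by rewrite size_map_inj_poly.
have toK0 p : (toK p).[0] = (p.[0])%:~R.
  by rewrite -[0 in LHS](rmorph0 (intr : int -> K)) horner_map.
have eqK : toK P ^+ 2 - toK D * toK Q ^+ 2 = 1.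
  by rewrite /toK -!rmorphXn -rmorphM -rmorphB eqPQ rmorph1.
have sD : s ^+ 2 = (toK D).[0] by rewrite toK0 Dn; case: K_s.
have := pell_power K_char _ eqK _ d_gt0 sD; rewrite !sz => /(_ szD szP); cbv zeta.
set r := lead_coef _ / _; set x0 := _ / (_ * r ^+ 2); set f := x0 ^+ 2 - _.
move=> [r0 f0 abE]; rewrite !toK0 Pa Qb in abE.
exists ((x0 + s / r) ^+ 2 / f) => //.
apply: (norm_one_units_root d_gt0); last first.
  rewrite -abE expr2 quad_intE.
  by apply: norm_one_unitsM; apply: pell_solution_unit.
have [tau tauE ->] := quadratic_conjugation.
have taus : tau s = - s.
  have := tauE 0 1; rewrite /quad !scale0r !add0r scaleN1r scale1r //.
have tauc p i : tau (toK p)`_i = (toK p)`_i by rewrite coef_map /= rmorph_int.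
have taur : tau r = r by rewrite /r fmorph_div /= !lead_coefE !tauc.
have taux0 : tau x0 = x0.
  by rewrite /x0 fmorph_div /= rmorphM rmorphXn /= taur tauc rmorph_nat.
have tauf : tau f = f.
  by rewrite /f rmorphB fmorph_div !rmorphXn /= taur taux0 tauc.
have tauu : tau (x0 + s / r) = x0 - s / r.
  by rewrite rmorphD /= taux0 (fmorph_div tau s r) taus taur mulNr.
rewrite fmorph_div rmorphXn /= tauu tauf.
have -> : (x0 + s / r) ^+ 2 / f * ((x0 - s / r) ^+ 2 / f)
    = ((x0 ^+ 2 - s ^+ 2 / r ^+ 2) / f) ^+ 2.
  by field; rewrite f0 r0.
by rewrite sD horner_coef0 -/f divff // expr1n.
Qed.

(** The two values of d correspond to the linear and to the quadratic
    substitution. *)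
Lemma unit_power_parametric a b (z : K) (d i : nat) (e : bool) :
    b <> 0 -> norm_one_units z -> (0 < i)%N -> d = i \/ d = (2 * i)%N ->
    a%:~R + b%:~R * s = (-1) ^+ e * z ^+ i ->
  exists P Q D : {poly int}, parametric_solution n a b P Q D /\ size P = d.+1.
Proof.
move=> b0 zU i_gt0 di abE.
have [x [y zE]] := quadP z; rewrite zE in zU abE.
have /norm_one_unitsP[xyN _] := zU.
rewrite quad_intE quad_exp // in abE.
have y0 : y != 0.
  apply/eqP => y0; case: b0; apply: (@intr_inj rat).
  move: abE; rewrite y0 mul0r; case: e; rewrite ?expr1 ?expr0 ?mul1r ?mulN1r ?quadN;
  by case/quad_inj => _ ->; rewrite ?oppr0.
have x1 : x + 1 != 0.
  apply: contraNneq y0 => x1; rewrite -sqrf_eq0.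
  have x1' : x = -1 by apply/eqP; rewrite -addr_eq0 x1.
  move: xyN; rewrite x1' sqrrN expr1n => /eqP.
  rewrite subr_eq addrC -subr_eq subrr eq_sym mulf_eq0.
  by rewrite intr_eq0 gt_eqF.
have [P [Q [D [PQD szP]]]] : exists P Q D, parametric_solution N (chebyshev x i).1
    (y * (chebyshev x i).2) P Q D /\ size P = d.+1.
  by case: di => ->; [apply: parametric_linear|apply: parametric_quadratic].
have [P' [Q' [PQD' szP']]] : exists P' Q', parametric_solution N a%:~R b%:~R P' Q' D
    /\ size P' = d.+1.
  case: e abE; rewrite ?expr1 ?expr0 ?mul1r ?mulN1r ?quadN => /quad_inj[-> ->].
    exists (- P), (- Q); rewrite size_polyN; split=> //.
    exact: parametric_solutionN.
  by exists P, Q.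
have [P'' [Q'' [D'' [PQD'' szP'']]]] := parametric_solution_int PQD'.
by exists P'', Q'', D''; rewrite szP''.
Qed.

End Quadratic.

Theorem theorem5 (n : int) (n_gt0 : 0 < n)
    (n_nonsquare : ~ exists m : int, n = m ^+ 2)
    (K : splittingFieldType rat) (s : K) (K_s : is_quadratic_field n s)
    (a b : int) (ab_pell : pell_solution n a b) (b_neq0 : b <> 0)
    (d : nat) (d_gt0 : (0 < d)%N) :
  (exists P Q D : {poly int},
     parametric_solution n a b P Q D /\ size P = d.+1) <->
  (d %| 2 * subgroup_index (@norm_one_units K) (pell_subgroup s a b))%N.
Proof.
have [h [m [e [h0 hP hfree m_gt0 abE]]]] :=
  pell_solution_power n_nonsquare K_s n_gt0 ab_pell b_neq0.
have -> : subgroup_index (@norm_one_units K) (pell_subgroup s a b) = m.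
  by rewrite /pell_subgroup abE index_signed_powers.
split=> [[P [Q [D [PQD szP]]]]|].
  have [z /hP[e' [k ->]]] :=
    parametric_solution_unit n_nonsquare K_s d_gt0 ab_pell PQD szP.
  rewrite abE mul1r !exprMn sqrr_sign mul1r -!exprM => hE.
  (* The sign of z contributes only a sign to the d-th power, which the freeness
     of h ignores. *)
  have kE : k * d%:Z = (m * 2)%N%:Z.
    apply: (signed_powers_inj h0 hfree (e := odd (e' * d)) (e' := false)).
    by rewrite signr_odd mul1r -exprz_exp; exact: esym.
  apply/dvdnP; exists `|k|%N.
  by rewrite -[d in RHS]absz_nat -abszM kE absz_nat mulnC.
case/dvdnP => k kE.
have hU j : norm_one_units (h ^+ j).
  by apply/hP; exists false, j%:Z; rewrite !mul1r.
have m_eq_kd : (d * k = 2 * m)%N by lia.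
have [d_odd|d_even] := boolP (odd d).
  have k2 : (k = 2 * (k %/ 2))%N.
    by rewrite mulnC divnK // -(@Gauss_dvdr _ d) ?coprime2n // m_eq_kd dvdn_mulr.
  apply: (unit_power_parametric n_nonsquare K_s n_gt0 (z := h ^+ (k %/ 2)) (i := d)) => //.
    by left.
  rewrite abE -exprM; congr (_ * _ ^+ _); lia.
have d2 : (d = 2 * (d %/ 2))%N by rewrite mulnC divnK // dvdn2.
apply: (unit_power_parametric n_nonsquare K_s n_gt0 (z := h ^+ k) (i := (d %/ 2)%N)) => //.
- by lia.
- by right.
rewrite abE -exprM; congr (_ * _ ^+ _); lia.
Qed.
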